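(* Let $a, b \in \mathbb{N}$ with $\gcd(a,b) = 1$. Write $$a = p_1^{\alpha_1} \cdots p_s^{\alpha_s}, \qquad b = q_1^{\beta_1} \cdots q_t^{\beta_t},$$ where $s, t \in \mathbb{Z}_{\geq 0}$, the primes $p_1, \ldots, p_s, q_1, \ldots, q_t$ are distinct, and the $\alpha_i, \beta_j$ are positive integers. Put $$g = \gcd(b, \alpha_1, \ldots, \alpha_s, \beta_1, \ldots, \beta_t).$$ Then the minimal polynomial of $(a/b)^{a/b}$ over $\mathbb{Z}$ is $$P(X) = b^{a/g} X^{b/g} - a^{a/g}.$$
   Context: $\mathbb{N}$ denotes the set of positive integers. The minimal polynomial over $\mathbb{Z}$ of an algebraic number $y$ is the primitive polynomial in $\mathbb{Z}[X]$ (the greatest common divisor of its coefficients is $1$) with positive leading coefficient that is irreducible over $\mathbb{Q}$ and has $y$ as a root. Powers of positive real numbers with rational exponents denote the positive real value; in particular $b^{a/g}$ and $a^{a/g}$ are positive real numbers (they are in fact integers, since $g$ divides every $\alpha_i$ and every $\beta_j$). *)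

(* Defs.v *)
From mathcomp Require Import all_boot all_order all_algebra.
From mathcomp Require Import reals.

Set Implicit Arguments.
Unset Strict Implicit.
Unset Printing Implicit Defensive.

Import GRing.Theory Num.Theory.
Local Open Scope ring_scope.

(* [zcontents P] is the gcd of the coefficients of P up to sign, hence the     *)
(* absolute value in the primitivity condition.                               *)
Definition is_minpolyZ (R : realType) (y : R) (P : {poly int}) : Prop :=
  [/\ `|zcontents P|%N = 1%N,
      0 < lead_coef P,
      irreducible_poly (map_poly (intr : int -> rat) P)
    & root (map_poly (intr : int -> R) P) y].

(* Main.v *)
Require Import Defs.
From mathcomp Require Import all_boot all_order all_algebra all_field.
From mathcomp Require Import reals exp.

Set Implicit Arguments.
Unset Strict Implicit.
Unset Printing Implicit Defensive.

Import GRing.Theory Num.Theory.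
Local Open Scope ring_scope.

(** Put [n = b / g] and let [A], [B] be the [g]-th roots of [a], [b], which are
    integers.  The announced polynomial is [B^a X^n - A^a]; it is primitive
    because [A] and [B] are coprime, and raising [(a/b)^(a/b)] to the power [n]
    gives [(a/b)^(a/g) = (A/B)^a], so it has the right root.

    Irreducibility is where [g] matters.  Let [c = (A/B)^a > 0].  All complex
    roots of [X^n - c] have the same absolute value, so the constant term of
    a monic factor of degree [m] over the rationals is, up to sign, a rational
    [r] with [r^n = c^m] ([dvdp_XnsubC_coef0]).  Hence [X^n - c] is irreducible
    as soon as such an equation forces [n] to divide [m]
    ([irreducible_XnsubC_rat]).  In our case, comparing the [l]-adic valuations
    on both sides of [r^n = (A/B)^(a m)] shows that [n] divides [a m v_l(A)]
    and [a m v_l(B)] for every [l] ([dvdn_logn_ratio]).  Multiplying by [g]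
    turns this into: [b] divides [a m alpha_i] and [a m beta_j], where the
    factor [a] can be dropped since [a] and [b] are coprime.  As [b] also
    divides [m b], it divides [m g], that is, [n] divides [m]. *)

(** * Irreducibility of binomials over the rationals *)

(** The complex roots [z] of [q] satisfy [z^n = c], and the normalized constant
    term of [q] is their product up to sign.  The [n]-th power and the absolute
    value remove the dependence on which roots occur and on the sign. *)
Lemma dvdp_XnsubC_coef0 (n : nat) (c : rat) (q : {poly rat}) :
  0 <= c -> q != 0 -> q %| 'X^n - c%:P ->
  `|q`_0 / lead_coef q| ^+ n = c ^+ (size q).-1.
Proof.
move=> c_ge0 q_neq0 q_dvd.
have lq0 : lead_coef q != 0 by rewrite lead_coef_eq0.
pose f : {rmorphism rat -> algC} := ratr.
have [rs qE] := closed_field_poly_normal (map_poly f q).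
have sz_rs : (size q).-1 = size rs.
  rewrite -(size_map_poly f) qE size_scale ?size_prod_XsubC //.
  by rewrite lead_coef_map fmorph_eq0.
have rs_root z : z \in rs -> z ^+ n = f c.
  move=> z_rs.
  have : root (map_poly f ('X^n - c%:P)) z.
    have qn : map_poly f q %| map_poly f ('X^n - c%:P) by rewrite dvdp_map.
    apply: root_dvdp qn _.
    by rewrite qE rootZ ?root_prod_XsubC // lead_coef_map fmorph_eq0.
  rewrite rmorphB /= map_polyXn map_polyC /root !hornerE subr_eq0.
  by move/eqP.
have q0E : f (q`_0 / lead_coef q) = (-1) ^+ size rs * \prod_(z <- rs) z.
  rewrite -coef0_prod_XsubC fmorph_div -coef_map -lead_coef_map.
  by rewrite {1}qE coefZ mulrAC divff ?mul1r // lead_coef_map fmorph_eq0.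
apply: (fmorph_inj f); rewrite rmorphXn rmorphXn /=.
have -> : f `|q`_0 / lead_coef q| = `|f (q`_0 / lead_coef q)| :> algC.
  by rewrite /f /= ratr_norm.
rewrite q0E normrM normrX normrN1 expr1n mul1r -normrX -prodrXl sz_rs.
rewrite (eq_big_seq (fun=> f c)) => [|z /rs_root //].
by rewrite big_const_seq count_predT iter_mulr_1 normrX ger0_norm ?ler0q.
Qed.

(** A nonconstant divisor of degree [m] yields the equation [r^n = c^m] by the
    previous lemma; then [n] divides [m > 0], so the divisor has full degree. *)
Lemma irreducible_XnsubC_rat (n : nat) (c : rat) :
  (0 < n)%N -> 0 <= c ->
  (forall (m : nat) (r : rat), r ^+ n = c ^+ m -> (n %| m)%N) ->
  irreducible_poly ('X^n - c%:P).
Proof.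
move=> n_gt0 c_ge0 n_dvd; split=> [|q q_neq1 q_dvd].
  by rewrite size_XnsubC.
have p_neq0 : 'X^n - c%:P != 0 by rewrite -size_poly_eq0 size_XnsubC.
have q_neq0 : q != 0 by apply: contraTneq q_dvd => ->; rewrite dvd0p.
have sq_gt0 : (0 < size q)%N by rewrite lt0n size_poly_eq0.
have m_gt0 : (0 < (size q).-1)%N by case: (size q) q_neq1 sq_gt0 => [|[]].
have /n_dvd/dvdn_leq := dvdp_XnsubC_coef0 c_ge0 q_neq0 q_dvd.
move=> /(_ m_gt0) n_le; rewrite -dvdp_size_eqp // eqn_leq dvdp_leq //=.
by rewrite size_XnsubC // -(prednK sq_gt0) ltnS.
Qed.

(** * Valuations *)

(** Coprimality prevents cancellation between [A] and [B]: at each [l] at most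
    one of the two valuations is nonzero.  Since [v_l(r^n)] is a multiple of
    [n], so is [e (v_l(A) - v_l(B))], and therefore each of its two terms. *)
Lemma dvdn_logn_ratio (A B n e : nat) (r : rat) (l : nat) :
  (0 < A)%N -> (0 < B)%N -> coprime A B ->
  r ^+ n = (A%:R / B%:R) ^+ e ->
  (n %| e * logn l A)%N /\ (n %| e * logn l B)%N.
Proof.
move=> A_gt0 B_gt0 cAB rE.
have nat_eq : (`|numq r| ^ n * B ^ e = A ^ e * `|denq r| ^ n)%N.
  rewrite -[B]absz_nat -[A]absz_nat -!abszX -!abszM; congr `|_|%N.
  apply: (@intr_inj rat); rewrite !rmorphM !rmorphXn /=.
  have BX0 : (B%:R : rat) ^+ e != 0 by rewrite expf_neq0 // pnatr_eq0 -lt0n.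
  have dX0 : ((denq r)%:~R : rat) ^+ n != 0.
    by rewrite expf_neq0 // intr_eq0 denq_neq0.
  by apply/eqP; rewrite -!pmulrn -eqr_div // -!expr_div_n divq_num_den rE.
have rhs_gt0 : (0 < A ^ e * `|denq r| ^ n)%N.
  by rewrite muln_gt0 !expn_gt0 A_gt0 absz_gt0 denq_neq0.
have num_gt0 : (0 < `|numq r| ^ n)%N.
  by move: rhs_gt0; rewrite -nat_eq muln_gt0 => /andP[].
have den_gt0 : (0 < `|denq r| ^ n)%N.
  by move: rhs_gt0; rewrite muln_gt0 => /andP[].
have := congr1 (logn l) nat_eq.
rewrite !lognM // ?expn_gt0 ?A_gt0 ?B_gt0 //.
rewrite !lognX => val_eq.
have [A0|B0] : logn l A = 0%N \/ logn l B = 0%N.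
  case: (posnP (logn l A)) => [|lA]; [by left | right].
  apply: logn_coprime; apply: coprime_dvdl cAB.
  by move: lA; rewrite logn_gt0 mem_primes => /and3P[].
- move: val_eq; rewrite A0 muln0 add0n => val_eq; split; first exact: dvdn0.
  rewrite -(dvdn_addr _ (dvdn_mulr (logn l `|numq r|) (dvdnn n))) val_eq.
  by rewrite dvdn_mulr.
move: val_eq; rewrite B0 muln0 addn0 => val_eq; split; last exact: dvdn0.
rewrite -(dvdn_addl _ (dvdn_mulr (logn l `|denq r|) (dvdnn n))) -val_eq.
by rewrite dvdn_mulr.
Qed.

Lemma dvdn_mul_biggcd (I : finType) (F : I -> nat) (b m : nat) :
  (forall i, b %| m * F i)%N -> (b %| m * \big[gcdn/0%N]_i F i)%N.
Proof.
move=> b_dvd; elim/big_ind: _ => [|x y bx by_|i _]; first by rewrite muln0.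
  by rewrite muln_gcdr dvdn_gcd bx.
exact: b_dvd.
Qed.

Lemma logn_prod_prime (k : nat) (p alpha : 'I_k -> nat) (i : 'I_k) :
  (forall j, prime (p j)) -> injective p ->
  logn (p i) (\prod_(j < k) p j ^ alpha j)%N = alpha i.
Proof.
move=> pp p_inj.
rewrite (bigD1 i) //= mulnC logn_Gauss ?pfactorK //.
elim/big_ind: _ => [|x y cx cy|j ji]; first exact: coprimen1.
  by rewrite coprimeMr cx.
rewrite coprimeXr // prime_coprime // dvdn_prime2 //.
by apply: contra ji => /eqP/p_inj->.
Qed.

Lemma prod_expn_div (k : nat) (p alpha : 'I_k -> nat) (g : nat) :
  (forall i, g %| alpha i)%N ->
  ((\prod_(i < k) p i ^ (alpha i %/ g)) ^ g)%N
  = (\prod_(i < k) p i ^ alpha i)%N.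
Proof.
move=> g_dvd; rewrite (big_morph (expn^~ g) (id1 := 1%N) (op1 := muln)) ?exp1n //.
  by apply: eq_bigr => i _; rewrite -expnM divnK.
by move=> x y; exact: expnMn.
Qed.

(** * The binomial [B^a X^n - A^a] *)

(** The content divides the coefficients [u] and [-v]; these sit at different
    degrees because [0 < n]. *)
Lemma zcontents_binomial (u v : int) (n : nat) :
  (0 < n)%N -> coprime `|u| `|v| -> `|zcontents (u *: 'X^n - v%:P)|%N = 1%N.
Proof.
move=> n_gt0 cuv; set P := _ - _.
have /polyOverP dP : P \is a polyOver (dvdz (zcontents P)).
  by rewrite -dvdz_contents.
apply/eqP; rewrite -dvdn1 -(eqP cuv) dvdn_gcd.
move: (dP n) (dP 0%N); rewrite !coefB !coefZ !coefXn !coefC eqxx /=.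
rewrite [0%N == n]eq_sym (gtn_eqF n_gt0) mulr1 mulr0 subr0 sub0r.
by rewrite !dvdzE abszN => -> ->.
Qed.

Lemma lead_coef_binomial (F : idomainType) (u v : F) (n : nat) :
  (0 < n)%N -> u != 0 -> lead_coef (u *: 'X^n - v%:P) = u.
Proof.
move=> n_gt0 u0; rewrite lead_coefDl ?lead_coefZ ?lead_coefXn ?mulr1 //.
rewrite size_polyN size_scale // size_polyXn ltnS.
by rewrite (leq_trans (size_polyC_leq1 _)).
Qed.

Lemma map_binomial (S : nzRingType) (u v : int) (n : nat) :
  map_poly (intr : int -> S) (u *: 'X^n - v%:P) = u%:~R *: 'X^n - (v%:~R)%:P.
Proof. by rewrite rmorphB /= map_polyZ map_polyXn map_polyC. Qed.

Lemma irreducible_binomial (F : fieldType) (u v : F) (n : nat) :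
  u != 0 -> irreducible_poly ('X^n - (v / u)%:P) ->
  irreducible_poly (u *: 'X^n - v%:P).
Proof.
move=> u0 [sz irr].
have -> : u *: 'X^n - v%:P = u *: ('X^n - (v / u)%:P).
  by rewrite scalerBr -!mul_polyC -polyCM mulrCA divff // mulr1.
split=> [|q q1]; first by rewrite size_scale.
rewrite dvdpZr // => /(irr q q1) h; apply: eqp_trans h _.
by rewrite eqp_sym eqp_scale.
Qed.

Lemma powR_exp_div (R : realType) (x : R) (g a : nat) :
  0 <= x -> (0 < g)%N -> (x ^+ g) `^ (a%:R / g%:R) = x ^+ a.
Proof.
move=> x_ge0 g_gt0; rewrite -powR_mulrn // -powRrM mulrCA divff ?mulr1.
  exact: powR_mulrn.
by rewrite pnatr_eq0 -lt0n.
Qed.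

Theorem theorem2p7 (R : realType) (a b : nat)
  (ha : (0 < a)%N) (hb : (0 < b)%N) (hab : coprime a b)
  (s t : nat) (p alpha : 'I_s -> nat) (q beta : 'I_t -> nat)
  (hp : forall i, prime (p i)) (hq : forall j, prime (q j))
  (p_inj : injective p) (q_inj : injective q)
  (hpq : forall i j, p i <> q j)
  (halpha : forall i, (0 < alpha i)%N) (hbeta : forall j, (0 < beta j)%N)
  (a_fact : a = (\prod_(i < s) p i ^ alpha i)%N)
  (b_fact : b = (\prod_(j < t) q j ^ beta j)%N)
  (g : nat)
  (g_def : g = gcdn b (gcdn (\big[gcdn/0%N]_(i < s) alpha i)
                            (\big[gcdn/0%N]_(j < t) beta j))) :
  exists2 P : {poly int},
    map_poly (intr : int -> R) P =
      ((b%:R : R) `^ (a%:R / g%:R)) *: 'X^(b %/ g)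
      - ((a%:R : R) `^ (a%:R / g%:R))%:P
  & is_minpolyZ ((a%:R / b%:R : R) `^ (a%:R / b%:R)) P.
Proof.
have g_gt0 : (0 < g)%N by rewrite g_def gcdn_gt0 hb.
have g_b : (g %| b)%N by rewrite g_def dvdn_gcdl.
have g_alpha i : (g %| alpha i)%N.
  rewrite g_def; apply: dvdn_trans (dvdn_gcdr _ _) _.
  by apply: dvdn_trans (dvdn_gcdl _ _) _; apply: biggcdn_inf.
have g_beta j : (g %| beta j)%N.
  rewrite g_def; apply: dvdn_trans (dvdn_gcdr _ _) _.
  by apply: dvdn_trans (dvdn_gcdr _ _) _; apply: biggcdn_inf.
pose A := (\prod_(i < s) p i ^ (alpha i %/ g))%N.
pose B := (\prod_(j < t) q j ^ (beta j %/ g))%N.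
pose n := (b %/ g)%N.
have AE : (A ^ g)%N = a by rewrite a_fact prod_expn_div.
have BE : (B ^ g)%N = b by rewrite b_fact prod_expn_div.
have A_gt0 : (0 < A)%N by move: ha; rewrite -AE expn_gt0 (gtn_eqF g_gt0) orbF.
have B_gt0 : (0 < B)%N by move: hb; rewrite -BE expn_gt0 (gtn_eqF g_gt0) orbF.
have cAB : coprime A B.
  by move: hab; rewrite -AE -BE coprime_pexpl ?coprime_pexpr.
have n_gt0 : (0 < n)%N by rewrite divn_gt0 // dvdn_leq.
have n_dvd m r : r ^+ n = ((A%:R / B%:R) ^+ a) ^+ m :> rat -> (n %| m)%N.
  rewrite -exprM => rE.
  (* Multiplying by g replaces n by b and the valuations of A, B by those of
     a, b; the factor a then disappears because it is coprime to b. *)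
  have scale l C : (n %| a * m * logn l C)%N -> (b %| m * logn l (C ^ g))%N.
    rewrite -(dvdn_pmul2r g_gt0) divnK // => h.
    rewrite -(Gauss_dvdr _ (n := a)) 1?coprime_sym // lognX.
    by rewrite [(g * _)%N]mulnC !mulnA.
  have val l := dvdn_logn_ratio l A_gt0 B_gt0 cAB rE.
  rewrite -(dvdn_pmul2r g_gt0) divnK // g_def !muln_gcdr !dvdn_gcd dvdn_mull //=.
  apply/andP; split; apply: dvdn_mul_biggcd => i.
    have [/scale] := val (p i).
    by rewrite AE a_fact logn_prod_prime.
  have [_ /scale] := val (q i).
  by rewrite BE {2}b_fact logn_prod_prime.
have BaR_neq0 (F : numDomainType) : (B ^ a)%N%:R != 0 :> F.
  by rewrite pnatr_eq0 expn_eq0 negb_and -lt0n B_gt0.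
pose P : {poly int} := (B ^ a)%N%:R *: 'X^n - ((A ^ a)%N%:R)%:P.
have mapP (S : nzRingType) :
    map_poly (intr : int -> S) P = (B ^ a)%N%:R *: 'X^n - ((A ^ a)%N%:R)%:P.
  by rewrite map_binomial !rmorph_nat.
exists P.
  have powE C c : (C ^ g)%N = c -> (c%:R : R) `^ (a%:R / g%:R) = (C ^ a)%N%:R.
    by move=> <-; rewrite !natrX powR_exp_div.
  by rewrite mapP (powE B) // (powE A).
split.
- apply: zcontents_binomial => //.
  by rewrite !natz !absz_nat coprimeXl // coprimeXr // coprime_sym.
- rewrite lead_coef_binomial ?BaR_neq0 //.
  by rewrite ltr0n expn_gt0 B_gt0.
- rewrite mapP; apply: irreducible_binomial; first exact: BaR_neq0.
  apply: (irreducible_XnsubC_rat n_gt0); first by rewrite divr_ge0.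
  by move=> m r; rewrite !natrX -expr_div_n => /n_dvd.
rewrite mapP /root !hornerE -powR_mulrn ?powR_ge0 // -powRrM.
have -> : a%:R / b%:R * n%:R = a%:R / g%:R :> R.
  rewrite -{1}(divnK g_b) natrM invfM mulrA mulrAC mulfVK //.
  by rewrite pnatr_eq0 -lt0n.
have -> : a%:R / b%:R = (A%:R / B%:R) ^+ g :> R.
  by rewrite expr_div_n -!natrX AE BE.
rewrite powR_exp_div ?divr_ge0 // expr_div_n -!natrX mulrCA divff ?BaR_neq0 //.
by rewrite mulr1 subrr.
Qed.
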